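(* Let $(M,\varphi,\xi,\eta,g)$ be a $(2n+1)$-dimensional Sasaki-like almost contact B-metric manifold and let $a,b,c,\lambda,\mu,\nu$ be real constants satisfying $$a+\lambda=0,\qquad b+\mu-1=0,\qquad c+\nu+1=0.$$ Then the manifold admits a Ricci-like soliton with potential $\xi$ and constants $(\lambda,\mu,\nu)$, where $\lambda+\mu+\nu=-2n$, if and only if it is Einstein-like with constants $(a,b,c)$, where $a+b+c=2n$. In particular: (i) The manifold admits an $\eta$-Ricci soliton with potential $\xi$ and constants $(\lambda,-2n-\lambda)$ if and only if it is Einstein-like with constants $(-\lambda,1,\lambda+2n-1)$. (ii) The manifold admits a shrinking Ricci soliton with potential $\xi$ and constant $-2n$ if and only if it is Einstein-like with constants $(2n,1,-1)$. (iii) The manifold is $\eta$-Einstein with constants $(a,2n-a)$ if and only if it admits a Ricci-like soliton with potential $\xi$ and constants $(-a,1,a-2n-1)$. (iv) The manifold is Einstein with constant $2n$ if and only if it admits a Ricci-like soliton with potential $\xi$ and constants $(-2n,1,-1)$.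
   Context: An almost contact B-metric manifold $(M,\varphi,\xi,\eta,g)$ is a smooth manifold of dimension $2n+1$ ($n\ge 1$) with an endomorphism $\varphi$ of $TM$, a (Reeb) vector field $\xi$, a 1-form $\eta$ and a pseudo-Riemannian metric $g$ of signature $(n+1,n)$ such that $\varphi\xi=0$, $\varphi^2=-\mathrm{id}+\eta\otimes\xi$, $\eta\circ\varphi=0$, $\eta(\xi)=1$, and $g(\varphi x,\varphi y)=-g(x,y)+\eta(x)\eta(y)$. The associated metric is $\tilde g(x,y)=g(x,\varphi y)+\eta(x)\eta(y)$. Here $x,y$ are arbitrary vector fields, $\nabla$ is the Levi-Civita connection of $g$, $R(x,y)z=\nabla_x\nabla_yz-\nabla_y\nabla_xz-\nabla_{[x,y]}z$, and $\rho(y,z)$ is the Ricci tensor of $g$, i.e. the trace of $x\mapsto R(x,y)z$. The manifold is Sasaki-like if $(\nabla_x\varphi)y=-g(x,y)\xi-\eta(y)x+2\eta(x)\eta(y)\xi$ for all $x,y$. It is Einstein-like with constants $(a,b,c)$ if $\rho=a\,g+b\,\tilde g+c\,\eta\otimes\eta$ with $a,b,c$ real constants; $\eta$-Einstein with constants $(a,c)$ if this holds with $b=0$; Einstein with constant $a$ if this holds with $b=c=0$. With $\mathcal L$ the Lie derivative, the manifold admits a Ricci-like soliton with potential $\xi$ and (real) constants $(\lambda,\mu,\nu)$ if $\frac12\mathcal L_\xi g+\rho+\lambda g+\mu\tilde g+\nu\,\eta\otimes\eta=0$; an $\eta$-Ricci soliton with potential $\xi$ and constants $(\lambda,\nu)$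 if this holds with $\mu=0$; a Ricci soliton with potential $\xi$ and constant $\lambda$ if this holds with $\mu=\nu=0$ (shrinking means $\lambda<0$). *)

(* Defs.v *)
From HB Require Import structures.
From mathcomp Require Import all_boot all_order all_algebra.
From mathcomp Require Import all_classical all_reals all_analysis.
Set Implicit Arguments.
Unset Strict Implicit.
Unset Printing Implicit Defensive.
Import Order.TTheory GRing.Theory Num.Theory.
Import numFieldNormedType.Exports.
Local Open Scope classical_set_scope.
Local Open Scope ring_scope.

(* C^k on an open set U.  The differential is the ambient one, so this is only
   meaningful (and only used) for open U. *)
Fixpoint Ck (R : realType) (V W : normedModType R) (k : nat) (U : set V)
    (f : V -> W) : Prop :=
  if k is k'.+1 then
    (forall x, U x -> differentiable f x) /\
    (forall v : V, Ck k' U (fun x => 'd f x v))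
  else forall x, U x -> {for x, continuous f}.

Definition smooth_on (R : realType) (V W : normedModType R) (U : set V)
    (f : V -> W) : Prop := forall k, Ck k U f.

(* The functions chart_map i and chart_inv i are total; they are mutually
   inverse homeomorphisms between dom i and its image, and carry no information
   elsewhere. *)
Record smoothManifold (R : realType) (m : nat) := SmoothManifold {
  carrier :> topologicalType ;
  chart : Type ;
  dom : chart -> set carrier ;
  chart_map : chart -> carrier -> 'rV[R]_m ;
  chart_inv : chart -> 'rV[R]_m -> carrier ;
  chart_at : carrier -> chart ;
  manifold_nonempty : [set: carrier] !=set0 ;
  manifold_hausdorff : hausdorff_space carrier ;
  manifold_second_countable : @second_countable carrier ;
  dom_open : forall i, open (dom i) ;
  image_open : forall i, open (chart_map i @` dom i) ;
  chart_mapK : forall i p, dom i p -> chart_inv i (chart_map i p) = p ;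
  chart_map_continuous : forall i p, dom i p ->
    {for p, continuous (chart_map i)} ;
  chart_inv_continuous : forall i x, (chart_map i @` dom i) x ->
    {for x, continuous (chart_inv i)} ;
  chart_at_dom : forall p, dom (chart_at p) p ;
  transition_smooth : forall i j,
    smooth_on (chart_map i @` (dom i `&` dom j)) (chart_map j \o chart_inv i)
}.

Section VectorFields.
Context {R : realType} {m : nat} {M : smoothManifold R m}.

(* The tangent space at p is 'rV[R]_m, a tangent vector being given by its
   components in the distinguished chart chart_at p.  A vector field, or a
   tensor field, is thus a map on M; its smoothness is a separate predicate,
   tested in all charts. *)
Definition vfield := M -> 'rV[R]_m.

Definition smooth_fun (f : M -> R) : Prop :=
  forall i, smooth_on (chart_map i @` dom i)
    (f \o chart_inv i : 'rV[R]_m -> R^o).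

(* Components in the chart i of the vector v tangent at p. *)
Definition tangent_coord (i : chart M) (p : M) (v : 'rV[R]_m) : 'rV[R]_m :=
  'd (chart_map i \o chart_inv (chart_at p)) (chart_map (chart_at p) p) v.

Definition local_rep (i : chart M) (X : vfield) (x : 'rV[R]_m) : 'rV[R]_m :=
  tangent_coord i (chart_inv i x) (X (chart_inv i x)).

Definition smooth_vf (X : vfield) : Prop :=
  forall i, smooth_on (chart_map i @` dom i) (local_rep i X).

(* X f, the derivative of the function f along X. *)
Definition lie_fun (X : vfield) (f : M -> R) (p : M) : R :=
  'd (f \o chart_inv (chart_at p) : 'rV[R]_m -> R^o)
    (chart_map (chart_at p) p) (X p).

(* [X, Y]^k = X^i d_i Y^k - Y^i d_i X^k in the chart chart_at p. *)
Definition bracket (X Y : vfield) : vfield := fun p =>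
  'd (local_rep (chart_at p) Y) (chart_map (chart_at p) p) (X p)
  - 'd (local_rep (chart_at p) X) (chart_map (chart_at p) p) (Y p).

(* Tensor fields are given by matrices acting on row vectors from the right:
   (1,1)-tensors by square matrices, 1-forms by columns, and (0,2)-tensors by
   Gram matrices. *)
Definition end_app (A : M -> 'M[R]_m) (X : vfield) : vfield :=
  fun p => X p *m A p.

Definition form_app (w : M -> 'cV[R]_m) (X : vfield) : M -> R :=
  fun p => (X p *m w p) 0 0.

Definition bil_app (h : M -> 'M[R]_m) (X Y : vfield) : M -> R :=
  fun p => (X p *m h p *m (Y p)^T) 0 0.

Record affine_connection (nabla : vfield -> vfield -> vfield) : Prop := {
  nabla_smooth : forall X Y, smooth_vf X -> smooth_vf Y ->
    smooth_vf (nabla X Y) ;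
  nabla_addl : forall X X' Y, smooth_vf X -> smooth_vf X' -> smooth_vf Y ->
    forall p, nabla (fun q => X q + X' q) Y p = nabla X Y p + nabla X' Y p ;
  nabla_scalel : forall f X Y, smooth_fun f -> smooth_vf X -> smooth_vf Y ->
    forall p, nabla (fun q => f q *: X q) Y p = f p *: nabla X Y p ;
  nabla_addr : forall X Y Y', smooth_vf X -> smooth_vf Y -> smooth_vf Y' ->
    forall p, nabla X (fun q => Y q + Y' q) p = nabla X Y p + nabla X Y' p ;
  nabla_leibniz : forall f X Y, smooth_fun f -> smooth_vf X -> smooth_vf Y ->
    forall p, nabla X (fun q => f q *: Y q) p
              = lie_fun X f p *: Y p + f p *: nabla X Y p
}.

Record levi_civita (g : M -> 'M[R]_m) (nabla : vfield -> vfield -> vfield)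
    : Prop := {
  levi_civita_connection : affine_connection nabla ;
  levi_civita_torsion_free : forall X Y, smooth_vf X -> smooth_vf Y ->
    forall p, nabla X Y p - nabla Y X p = bracket X Y p ;
  levi_civita_metric : forall X Y Z,
    smooth_vf X -> smooth_vf Y -> smooth_vf Z ->
    forall p, lie_fun X (bil_app g Y Z) p
              = bil_app g (nabla X Y) Z p + bil_app g Y (nabla X Z) p
}.

Definition curvature (nabla : vfield -> vfield -> vfield) (X Y Z : vfield)
    : vfield := fun p =>
  nabla X (nabla Y Z) p - nabla Y (nabla X Z) p - nabla (bracket X Y) Z p.

(* rho (Y, Z) at p is the trace of the endomorphism L of the tangent space at p
   induced by X |-> R(X, Y)Z.  As R is tensorial and every tangent vector
   extends to a smooth vector field, exactly one such L exists, so that this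
   determines rho on smooth vector fields. *)
Definition ricci_tensor (nabla : vfield -> vfield -> vfield)
    (rho : vfield -> vfield -> M -> R) : Prop :=
  forall Y Z, smooth_vf Y -> smooth_vf Z -> forall (p : M) (L : 'M[R]_m),
    (forall X, smooth_vf X -> curvature nabla X Y Z p = X p *m L) ->
    rho Y Z p = \tr L.

Definition lie_metric (X : vfield) (g : M -> 'M[R]_m) (Y Z : vfield) (p : M)
    : R :=
  lie_fun X (bil_app g Y Z) p - bil_app g (bracket X Y) Z p
  - bil_app g Y (bracket X Z) p.

(* (nabla_X A) Y for an endomorphism field A. *)
Definition nabla_end (nabla : vfield -> vfield -> vfield) (A : M -> 'M[R]_m)
    (X Y : vfield) : vfield := fun p =>
  nabla X (end_app A Y) p - end_app A (nabla X Y) p.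

End VectorFields.
Arguments vfield {R m} M.

(* The symmetric bilinear form with Gram matrix h has signature (k, m - k):
   some basis, given by the rows of P, is orthonormal with k signs +1 and
   m - k signs -1. *)
Definition has_signature (R : realType) (m k : nat) (h : 'M[R]_m) : Prop :=
  exists2 P : 'M[R]_m, P \in unitmx &
    P *m h *m P^T = diag_mx (\row_(i < m) if (i < k)%N then 1 else -1).

Record almostContactBMetric (R : realType) (n : nat)
    (M : smoothManifold R (n.*2.+1)) := AlmostContactBMetric {
  acb_phi : M -> 'M[R]_(n.*2.+1) ;
  acb_xi : vfield M ;
  acb_eta : M -> 'cV[R]_(n.*2.+1) ;
  acb_g : M -> 'M[R]_(n.*2.+1) ;
  acb_phi_smooth : forall X, smooth_vf X -> smooth_vf (end_app acb_phi X) ;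
  acb_xi_smooth : smooth_vf acb_xi ;
  acb_eta_smooth : forall X, smooth_vf X -> smooth_fun (form_app acb_eta X) ;
  acb_g_smooth : forall X Y, smooth_vf X -> smooth_vf Y ->
    smooth_fun (bil_app acb_g X Y) ;
  acb_g_sym : forall p, (acb_g p)^T = acb_g p ;
  acb_g_signature : forall p, has_signature n.+1 (acb_g p) ;
  acb_phi_xi : forall p, end_app acb_phi acb_xi p = 0 ;
  acb_phi_sq : forall (X : vfield M) p,
    end_app acb_phi (end_app acb_phi X) p
    = - X p + form_app acb_eta X p *: acb_xi p ;
  acb_eta_phi : forall (X : vfield M) p,
    form_app acb_eta (end_app acb_phi X) p = 0 ;
  acb_eta_xi : forall p, form_app acb_eta acb_xi p = 1 ;
  acb_g_phi : forall (X Y : vfield M) p,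
    bil_app acb_g (end_app acb_phi X) (end_app acb_phi Y) p
    = - bil_app acb_g X Y p + form_app acb_eta X p * form_app acb_eta Y p
}.

Section SasakiLike.
Context {R : realType} {n : nat} {M : smoothManifold R (n.*2.+1)}.
Variable S : almostContactBMetric M.

Local Notation phi := (end_app (acb_phi S)).
Local Notation xi := (acb_xi S).
Local Notation eta := (form_app (acb_eta S)).
Local Notation g := (bil_app (acb_g S)).

Definition assoc_metric (X Y : vfield M) (p : M) : R :=
  g X (phi Y) p + eta X p * eta Y p.

Definition sasaki_like (nabla : vfield M -> vfield M -> vfield M) : Prop :=
  forall X Y, smooth_vf X -> smooth_vf Y -> forall p,
    nabla_end nabla (acb_phi S) X Y p
    = - (g X Y p *: xi p) - eta Y p *: X p + (2 * eta X p * eta Y p) *: xi p.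

Variable rho : vfield M -> vfield M -> M -> R.

Definition einstein_like (a b c : R) : Prop :=
  forall X Y, smooth_vf X -> smooth_vf Y -> forall p,
    rho X Y p
    = a * g X Y p + b * assoc_metric X Y p + c * (eta X p * eta Y p).

Definition eta_einstein (a c : R) : Prop := einstein_like a 0 c.

Definition einstein (a : R) : Prop := einstein_like a 0 0.

(* All solitons below have potential xi. *)
Definition ricci_like_soliton (lambda mu nu : R) : Prop :=
  forall X Y, smooth_vf X -> smooth_vf Y -> forall p,
    2^-1 * lie_metric xi (acb_g S) X Y p + rho X Y p + lambda * g X Y p
    + mu * assoc_metric X Y p + nu * (eta X p * eta Y p) = 0.

Definition eta_ricci_soliton (lambda nu : R) : Prop :=
  ricci_like_soliton lambda 0 nu.

Definition ricci_soliton (lambda : R) : Prop := ricci_like_soliton lambda 0 0.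

Definition shrinking_ricci_soliton (lambda : R) : Prop :=
  lambda < 0 /\ ricci_soliton lambda.

End SasakiLike.

(* Main.v *)
Require Import Defs.
From mathcomp Require Import all_boot all_order all_algebra.
From mathcomp Require Import all_classical all_reals all_analysis.
From mathcomp Require Import ring lra.
Import Order.TTheory GRing.Theory Num.Theory.
Import numFieldNormedType.Exports.
Local Open Scope classical_set_scope.
Local Open Scope ring_scope.

(** Everything follows from two facts about the Reeb field [xi].

    Applying the Sasaki-like identity to [y = xi] gives
    [phi (nabla_x xi) = - phi^2 x], and [nabla_x xi] has no component along [xi]
    because [g(xi, xi) = 1] is constant and the connection is metric; hence
    [nabla_x xi = - phi x] ([nabla_xi]).

    First, since [g(phi x, y) = g(x, phi y)], half the Lie derivative of [g]
    along [xi] is [- g(x, phi y)] ([lie_metric_xi]), that is,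
    [eta * eta - tilde g].  The soliton equation is therefore
    [rho + lambda g + (mu - 1) tilde g + (nu + 1) eta * eta = 0], which is the
    Einstein-like equation for the constants [(a, b, c)] tied to
    [(lambda, mu, nu)] by the three given relations
    ([soliton_einstein_like]).

    Second, the Sasaki-like identity also gives [nabla_xi phi = 0], so that
    [R(x, xi) xi = - phi^2 x = x - eta(x) xi] ([curvature_xi]).  The trace of
    this projection is [2n], so [rho(xi, xi) = 2n] ([ricci_xi]).  As [g],
    [tilde g] and [eta * eta] all take the value 1 on [(xi, xi)], an
    Einstein-like Ricci tensor has [a + b + c = 2n] ([einstein_like_sum]); the
    value of [lambda + mu + nu] follows from the relations between the
    constants.

    The connection is only constrained on smooth fields, so differentiating
    along the bracket [[x, xi] = nabla_x xi - nabla_xi x] takes the smoothness of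
    a difference of smooth fields ([smooth_vfB]). *)

(** * Differences of smooth maps and vector fields *)

Section Smoothness.
Context {R : realType}.

Lemma near_eq_is_diff (V W : normedModType R) (f g : V -> W) (x : V) :
  (\forall y \near x, f y = g y) -> differentiable f x ->
  differentiable g x /\ 'd g x = 'd f x :> (V -> W).
Proof.
move=> fg df; have [dfc dfx] := (diff_locallyP x f).1 df.
have dg : g \o shift x = cst (g x) + 'd f x +o_ 0 id.
  apply/eqaddoP => e e0.
  move/eqaddoP: dfx => /(_ e e0).
  have : \forall h \near (0 : V), f (h + x) = g (h + x).
    by move: fg; rewrite (near_shift 0); apply: filterS => y /=; rewrite subr0.
  apply: filterS2 => h /= fgh.
  have fgx : f x = g x := nbhs_singleton fg.
  by rewrite -![(_ + _ : V -> W) _]/(_ + _) -![(- _ : V -> W) _]/(- _) /= fgh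
    /cst /= fgx.
have eqd := diff_unique dfc dg.
split; last exact: eqd.
by apply: (diff_locallyP x g).2; rewrite eqd; split; [exact dfc|exact dg].
Qed.

(** The iterated differentials in [Ck] are taken of maps on the whole space, so
    the difference is controlled on [U] only: the induction goes through for
    any [h] that agrees with [f - g] on [U], because [U] is open and
    differentials are local. *)
Lemma Ck_eqB (V W : normedModType R) k (U : set V) (f g h : V -> W) :
  open U -> (forall x, U x -> h x = f x - g x) ->
  Ck k U f -> Ck k U g -> Ck k U h.
Proof.
move=> Uo; elim: k f g h => [|k IHk] f g h hE /=.
  move=> fc gc x Ux.
  have hfg : \forall y \near x, f y - g y = h y.
    by near=> y; rewrite hE//; near: y; exact: open_nbhs_nbhs.
  have : {for x, continuous (f \- g)} by apply: continuousB; [exact: fc|exact: gc].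
  rewrite /prop_for /continuous_at /= -(hE x Ux) => c.
  by apply: cvg_trans c; apply: near_eq_cvg.
move=> [fd fC] [gd gC].
have hd x : U x -> differentiable h x /\ 'd h x = 'd (f \- g) x :> (V -> W).
  move=> Ux; apply: near_eq_is_diff.
    by near=> y; rewrite /= hE//; near: y; exact: open_nbhs_nbhs.
  by apply: differentiableB; [exact: fd|exact: gd].
split=> [x /hd[]//|v].
apply: (IHk (fun x => 'd f x v) (fun x => 'd g x v)) => // x Ux.
by rewrite (hd x Ux).2 diffB//; [exact: fd|exact: gd].
Unshelve. all: by end_near. Qed.

Lemma smooth_vfB {m} {M : smoothManifold R m} (X Y : vfield M) :
  smooth_vf X -> smooth_vf Y -> smooth_vf (fun p => X p - Y p).
Proof.
move=> Xs Ys i k; apply: (Ck_eqB _ _ k _ (local_rep i X) (local_rep i Y)).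
- exact: image_open.
- by move=> x _; rewrite /local_rep /tangent_coord linearB.
- exact: Xs.
- exact: Ys.
Qed.

End Smoothness.

(** * Bilinear fields and connections *)

Section Pointwise.
Context {R : realType} {m : nat} {M : smoothManifold R m}.
Implicit Types (X Y Z : vfield M) (h : M -> 'M[R]_m) (p : M).

Lemma bil_app_linl h X X1 X2 Y p a : X p = a *: X1 p + X2 p ->
  bil_app h X Y p = a * bil_app h X1 Y p + bil_app h X2 Y p.
Proof. by move=> E; rewrite /bil_app E !mulmxDl -!scalemxAl !mxE. Qed.

Lemma bil_app0l h X Y p : X p = 0 -> bil_app h X Y p = 0.
Proof. by move=> E; rewrite /bil_app E !mul0mx mxE. Qed.

Lemma bil_appC h X Y p : (h p)^T = h p -> bil_app h X Y p = bil_app h Y X p.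
Proof.
move=> hT; rewrite /bil_app -[in LHS](trmxK (X p)) -{1}hT -!trmx_mul mxE.
by rewrite mulmxA.
Qed.

Lemma nabla_zero {nabla} X p : affine_connection nabla ->
  smooth_vf X -> smooth_vf (fun _ : M => 0) ->
  nabla X (fun=> 0) p = 0.
Proof.
move=> nablaP Xs zs; have := nabla_addr nablaP Xs zs zs p.
under [fun q : M => _ + _]funext do rewrite addr0.
by move/(congr1 (fun v => v - nabla X (fun=> 0) p)); rewrite addrK subrr.
Qed.

Lemma lie_fun_cst X (f : M -> R) c p : f = (fun=> c) -> lie_fun X f p = 0.
Proof. by move=> ->; rewrite /lie_fun diff_cst. Qed.

End Pointwise.

(** * Algebra of an almost contact B-metric structure *)

Section Structure.
Context {R : realType} {n : nat} {M : smoothManifold R n.*2.+1}.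
Variable S : almostContactBMetric M.
Implicit Types (X Y Z : vfield M) (p : M).

Local Notation phi := (end_app (acb_phi S)).
Local Notation xi := (acb_xi S).
Local Notation eta := (form_app (acb_eta S)).
Local Notation g := (bil_app (acb_g S)).

Lemma metricC X Y p : g X Y p = g Y X p.
Proof. exact/bil_appC/acb_g_sym. Qed.

(** Compatibility of [g] with [phi], at [Y = xi], where [phi xi = 0]. *)
Lemma metric_xi X p : g X xi p = eta X p.
Proof.
have := acb_g_phi S X xi p.
rewrite metricC bil_app0l ?acb_phi_xi// acb_eta_xi mulr1 => /eqP.
by rewrite eq_sym addrC subr_eq0 => /eqP.
Qed.

(** Compatibility of [g] with [phi], at the pair [(X, phi Y)]: [phi^2 Y] is
    [- Y] up to a multiple of [xi], and [xi] is orthogonal to [phi X]. *)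
Lemma metric_phiC X Y p : g (phi X) Y p = g X (phi Y) p.
Proof.
have := acb_g_phi S X (phi Y) p.
rewrite acb_eta_phi mulr0 addr0 metricC.
rewrite (bil_app_linl _ _ Y (fun q => eta Y q *: xi q) _ _ (-1)); last first.
  by rewrite scaleN1r acb_phi_sq.
rewrite (bil_app_linl _ (fun q => eta Y q *: xi q) xi (fun=> 0) _ _ (eta Y p));
  last by rewrite addr0.
rewrite (bil_app0l _ (fun=> 0))// [g xi _ _]metricC metric_xi acb_eta_phi.
by rewrite mulr0 !addr0 mulN1r [g Y _ p]metricC => /eqP; rewrite eqr_opp => /eqP.
Qed.

Lemma phiN X p : phi (fun q => - X q) p = - phi X p.
Proof. by rewrite /end_app mulNmx. Qed.

Lemma phiB X Y p : phi (fun q => X q - Y q) p = phi X p - phi Y p.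
Proof. by rewrite /end_app mulmxBl. Qed.

(** * The Reeb field of a Sasaki-like manifold *)

Section Sasaki.
Variable nabla : vfield M -> vfield M -> vfield M.
Hypothesis nablaP : levi_civita (acb_g S) nabla.
Hypothesis sasaki : sasaki_like S nabla.

Let xis : smooth_vf xi := acb_xi_smooth S.
Let conn : affine_connection nabla := levi_civita_connection nablaP.

(** The zero field is smooth, being the smooth field [phi xi]. *)
Lemma smooth_zero : smooth_vf (fun _ : M => 0).
Proof.
rewrite (_ : (fun=> _) = phi xi); first exact: acb_phi_smooth.
by apply/funext => p; rewrite acb_phi_xi.
Qed.

(** The derivative of the constant [g(xi, xi) = 1] along [X] is
    [2 g(nabla_X xi, xi)]. *)
Lemma eta_nabla_xi X p : smooth_vf X -> eta (nabla X xi) p = 0.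
Proof.
move=> Xs; have := levi_civita_metric nablaP Xs xis xis p.
rewrite (lie_fun_cst _ _ 1); last first.
  by apply/funext => q; rewrite metric_xi acb_eta_xi.
by rewrite [g xi _ _]metricC metric_xi; lra.
Qed.

(** The Sasaki-like identity at [xi] reads [phi (nabla_X xi) = - phi^2 X].  As
    [nabla_X xi] is orthogonal to [xi], where [phi^2 = - id], applying [phi] once
    more determines it. *)
Lemma nabla_xi X : smooth_vf X -> nabla X xi = (fun p => - phi X p).
Proof.
move=> Xs.
have E : phi (nabla X xi) = (fun p => - phi (phi X) p).
  apply/funext => p; have := sasaki _ _ Xs xis p.
  rewrite /nabla_end (_ : phi xi = (fun=> 0)); last exact/funext/acb_phi_xi.
  rewrite (nabla_zero _ _ conn Xs smooth_zero) sub0r.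
  rewrite metric_xi acb_eta_xi scale1r mulr1 acb_phi_sq => /eqP; rewrite eqr_oppLR => /eqP ->.
  by rewrite mulr_natl mulr2n scalerDl [- _ - _]addrC addrA addrNK addrC.
apply/funext => p; have := acb_phi_sq S (nabla X xi) p.
rewrite E phiN eta_nabla_xi// scale0r addr0 => /eqP; rewrite eqr_opp => /eqP <-.
by rewrite acb_phi_sq acb_eta_phi scale0r addr0.
Qed.

(** Torsion-freeness turns the Lie derivative into
    [g(nabla_X xi, Y) + g(X, nabla_Y xi)], and the two terms are equal by
    [metric_phiC]. *)
Lemma lie_metric_xi X Y p : smooth_vf X -> smooth_vf Y ->
  lie_metric xi (acb_g S) X Y p = - (2 * g X (phi Y) p).
Proof.
move=> Xs Ys; rewrite /lie_metric (levi_civita_metric nablaP xis Xs Ys).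
have brE Z W : smooth_vf Z ->
    g (bracket xi Z) W p = g (nabla xi Z) W p + g (phi Z) W p.
  move=> Zs; have brp : bracket xi Z p = 1 *: nabla xi Z p + phi Z p.
    rewrite -(levi_civita_torsion_free nablaP xis Zs) nabla_xi// opprK.
    by rewrite scale1r.
  by rewrite (bil_app_linl _ _ _ _ _ _ _ brp) mul1r.
rewrite brE// [g X (bracket _ _) p]metricC brE// [g (nabla xi Y) X p]metricC.
by rewrite [g (phi Y) X p]metricC metric_phiC; ring.
Qed.

(** [nabla_xi phi = 0]: with [xi] as direction of differentiation, the three
    terms of the Sasaki-like identity are [- eta(X) xi], [- eta(X) xi] and
    [2 eta(X) xi]. *)
Lemma nabla_xi_phi X p : smooth_vf X ->
  nabla xi (phi X) p = phi (nabla xi X) p.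
Proof.
move=> Xs; apply/eqP; rewrite -subr_eq0; apply/eqP.
rewrite -/(nabla_end nabla (acb_phi S) xi X p) sasaki// metricC metric_xi.
by rewrite acb_eta_xi mulr1 mulr_natl mulr2n scalerDl addrA addrNK addNr.
Qed.

(** With [nabla_X xi = - phi X], the curvature is
    [0 + nabla_xi (phi X) + phi [X, xi]].  The first part is
    [phi (nabla_xi X)], which cancels against the same term in
    [phi [X, xi] = - phi^2 X - phi (nabla_xi X)]. *)
Lemma curvature_xi X p : smooth_vf X ->
  curvature nabla X xi xi p = X p - eta X p *: xi p.
Proof.
move=> Xs; have phiXs : smooth_vf (phi X) by exact: acb_phi_smooth.
have brE : bracket X xi = (fun q => nabla X xi q - nabla xi X q).
  by apply/funext => q; rewrite (levi_civita_torsion_free nablaP).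
have brs : smooth_vf (bracket X xi).
  by rewrite brE; apply: smooth_vfB; exact: nabla_smooth.
rewrite /curvature (nabla_xi _ brs) (nabla_xi _ xis).
rewrite (_ : (fun q => - phi xi q) = (fun=> 0)); last first.
  by apply/funext => q; rewrite acb_phi_xi oppr0.
rewrite (nabla_zero _ _ conn Xs smooth_zero) sub0r opprK.
(* [nabla X xi + phi X] is the zero field, and so is its derivative. *)
have -> : nabla xi (nabla X xi) p = - phi (nabla xi X) p.
  apply/eqP; rewrite -addr_eq0 -nabla_xi_phi//.
  rewrite -(nabla_addr conn xis _ phiXs); last exact: nabla_smooth.
  rewrite (_ : (fun q => _) = (fun=> 0)); last first.
    by apply/funext => q; rewrite nabla_xi// addNr.
  by rewrite (nabla_zero _ _ conn xis smooth_zero).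
by rewrite opprK brE phiB addrC subrK nabla_xi// phiN acb_phi_sq opprD opprK.
Qed.

Lemma ricci_xi rho p : ricci_tensor nabla rho -> rho xi xi p = 2 * n%:R.
Proof.
move=> rhoP.
rewrite (rhoP _ _ xis xis p (1%:M - acb_eta S p *m xi p)); last first.
  move=> X Xs; rewrite curvature_xi// mulmxBr mulmx1 mulmxA.
  by rewrite [X p *m acb_eta S p]mx11_scalar mul_scalar_mx.
rewrite linearB /= mxtrace1 mxtrace_mulC /mxtrace big_ord1.
rewrite -[X in _ - X]/(eta xi p) acb_eta_xi -addn1 natrD addrK.
by rewrite -mul2n natrM.
Qed.

(** The equation is evaluated on [(xi, xi)] at any point of [M]. *)
Lemma einstein_like_sum rho a b c : ricci_tensor nabla rho ->
  einstein_like S rho a b c -> a + b + c = 2 * n%:R.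
Proof.
move=> rhoP; have [p _] := manifold_nonempty M.
move=> /(_ _ _ xis xis p); rewrite (ricci_xi _ _ rhoP) /assoc_metric.
rewrite metric_xi -metric_phiC metric_xi acb_eta_phi acb_eta_xi => ->; ring.
Qed.

(** By [lie_metric_xi], the Lie derivative only shifts the coefficients of
    [tilde g] and of [eta * eta], by [-1] and [1]. *)
Lemma soliton_einstein_like rho a b c lambda mu nu :
  a + lambda = 0 -> b + mu - 1 = 0 -> c + nu + 1 = 0 ->
  ricci_like_soliton S rho lambda mu nu <-> einstein_like S rho a b c.
Proof.
move=> al bm cn.
have -> : lambda = - a by lra.
have -> : mu = 1 - b by lra.
have -> : nu = - c - 1 by lra.
by split=> H X Y Xs Ys p; have := H X Y Xs Ys p; rewrite lie_metric_xi//
  /assoc_metric; lra.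
Qed.

End Sasaki.
End Structure.

Theorem theorem3p4 (R : realType) (n : nat) (n_ge1 : (1 <= n)%N)
    (M : smoothManifold R n.*2.+1) (S : almostContactBMetric M)
    (nabla : vfield M -> vfield M -> vfield M)
    (nablaP : levi_civita (acb_g S) nabla)
    (rho : vfield M -> vfield M -> M -> R)
    (rhoP : ricci_tensor nabla rho)
    (sasaki : sasaki_like S nabla) :
  (forall a b c lambda mu nu : R,
     a + lambda = 0 -> b + mu - 1 = 0 -> c + nu + 1 = 0 ->
     [/\ ricci_like_soliton S rho lambda mu nu /\
           lambda + mu + nu = - (2 * n%:R) <->
         einstein_like S rho a b c /\ a + b + c = 2 * n%:R,
         ricci_like_soliton S rho lambda mu nu ->
           lambda + mu + nu = - (2 * n%:R) &
         einstein_like S rho a b c -> a + b + c = 2 * n%:R]) /\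
  [/\ forall lambda : R,
        eta_ricci_soliton S rho lambda (- (2 * n%:R) - lambda) <->
        einstein_like S rho (- lambda) 1 (lambda + 2 * n%:R - 1),
      shrinking_ricci_soliton S rho (- (2 * n%:R)) <->
        einstein_like S rho (2 * n%:R) 1 (-1),
      forall a : R,
        eta_einstein S rho a (2 * n%:R - a) <->
        ricci_like_soliton S rho (- a) 1 (a - 2 * n%:R - 1) &
      einstein S rho (2 * n%:R) <->
        ricci_like_soliton S rho (- (2 * n%:R)) 1 (-1)].
Proof.
have solE := soliton_einstein_like S nabla nablaP sasaki rho.
have sumE := fun a b c => einstein_like_sum S nabla nablaP sasaki rho a b c rhoP.
split=> [a b c lambda mu nu al bm cn|].
  have E := solE _ _ _ _ _ _ al bm cn.
  split=> [||/sumE//]; last by move=> /E/sumE; lra.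
  by rewrite E; split=> -[H s]; split=> //; lra.
split=> [lambda||a|].
- by apply: solE; lra.
- rewrite /shrinking_ricci_soliton /ricci_soliton (solE (2 * n%:R) 1 (-1)); [|lra..].
  split=> [[]//|H]; split=> //.
  by rewrite oppr_lt0 mulr_gt0 ?ltr0n.
- by symmetry; apply: solE; lra.
- by symmetry; apply: solE; lra.
Qed.
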